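(* Let $n,m,\ell,N,K\in\mathbb{N}$, let $(\Delta,\mathcal{D},\mathbb{P})$ be a probability space with $\Delta\subseteq\mathbb{R}^\ell$, and let $A:\mathbb{R}^\ell\to\mathbb{R}^{n\times n}$, $B:\mathbb{R}^\ell\to\mathbb{R}^{n\times m}$. Let $\mathscr{X}\subseteq\mathbb{R}^n$ be a C-set, let $\mathscr{U}\subseteq\mathbb{R}^m$ be a C-polytope, and let $\mathcal{S}\subseteq\mathscr{X}$ be a C-polytope with vertices $x_1,\dots,x_N$. Fix $\beta\in(0,1)$ and let $\varepsilon:\{0,1,\dots,K\}\to[0,1]$ be a function with $\varepsilon(K)=1$ and $$\sum_{h=0}^{K-1}\binom{K}{h}\bigl(1-\varepsilon(h)\bigr)^{K-h}=\beta .$$ Assume that $\mathcal{L}_{\delta_K}\neq\emptyset$ for the $K$-multisamples $\delta_K\in\Delta^K$ under consideration (i.e. for every $\delta_K\in\Delta^K$). Then, for any choice of the tie-break maps $\Theta_p$, of the support-subsample algorithm $\Upsilon_K$, and of the probability measure $\mathbb{P}$, writing $(\boldsymbol{C}^\star_K,\boldsymbol{d}^\star_K)=\Theta_K(\delta_K)$ and $s_K=|\Upsilon_K(\delta_K)|$, $$\mathbb{P}^K\Bigl\{\delta_K\in\Delta^K \;\Big|\; V\bigl(\boldsymbol{C}^\star_K\,\cdot+\boldsymbol{d}^\star_K\bigr)>\varepsilon(s_K)\Bigr\}\le\beta .$$ That is, with confidence at least $1-\beta$, the probability (over a new independent draw $\delta\sim\mathbb{P}$) that the affine policy returns admissible vertex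 inputs certifying controlled invariance of $\mathcal{S}$ for $x^+=A(\delta)x+B(\delta)u$ is at least $1-\varepsilon(s_K)$.
   Context: A C-set is a convex bounded set containing the origin in its interior; a C-polytope is a polyhedral C-set. $\mathbb{P}^K$ is the $K$-fold product measure on $\Delta^K$; a $K$-multisample $\delta_K=(\delta^{(1)},\dots,\delta^{(K)})\in\Delta^K$ consists of $K$ i.i.d. draws from $\mathbb{P}$. Let $\mathcal{M}$ be the set of pairs $(\boldsymbol{C},\boldsymbol{d})$ with $\boldsymbol{C}=\mathrm{col}(C_1,\dots,C_N)$, $C_i\in\mathbb{R}^{m\times\ell}$, and $\boldsymbol{d}=\mathrm{col}(d_1,\dots,d_N)$, $d_i\in\mathbb{R}^m$; such a pair defines the affine policy $\delta\mapsto\boldsymbol{C}\delta+\boldsymbol{d}=\mathrm{col}(C_1\delta+d_1,\dots,C_N\delta+d_N)$. For $\delta\in\Delta$ define $\mathcal{U}_\delta=\{\boldsymbol{u}=\mathrm{col}(u_1,\dots,u_N)\in\mathscr{U}^N : A(\delta)x_i+B(\delta)u_i\in\mathcal{S}\ \forall i\}$ and $\mathcal{L}_\delta=\{(\boldsymbol{C},\boldsymbol{d})\in\mathcal{M} : C_i\delta+d_i\in\mathscr{U},\ A(\delta)x_i+B(\delta)(C_i\delta+d_i)\in\mathcal{S}\ \forall i=1,\dots,N\}$, and for a multisample $\mathcal{L}_{\delta_K}=\bigcap_{j=1}^K\mathcal{L}_{\delta^{(j)}}$. For each $p\in\mathbb{N}$, $\Theta_p:\Delta^p\to\mathcal{M}$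 is a single-valued map (a tie-break rule) assigning to each $p$-multisample with nonempty $\mathcal{L}$ an element of that set. A support subsample of $\delta_K$ is a tuple $(\delta^{(i_1)},\dots,\delta^{(i_p)})$ with $i_1<\dots<i_p$ such that $\Theta_p(\delta^{(i_1)},\dots,\delta^{(i_p)})=\Theta_K(\delta_K)$; $\Upsilon_K$ is any map returning, for each $\delta_K$, an index set $\{i_1,\dots,i_p\}$ of a support subsample. For $(\boldsymbol{C},\boldsymbol{d})\in\mathcal{M}$, the violation probability is $V(\boldsymbol{C}\,\cdot+\boldsymbol{d})=\mathbb{P}\{\delta\in\Delta : \boldsymbol{C}\delta+\boldsymbol{d}\notin\mathcal{U}_\delta\}$. *)

(* Defs.v *)
From HB Require Import structures.
From mathcomp Require Import all_boot all_order all_algebra.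
From mathcomp Require Import all_classical all_reals all_analysis.
Set Implicit Arguments. Unset Strict Implicit. Unset Printing Implicit Defensive.
Import Order.TTheory GRing.Theory Num.Theory.
Import numFieldNormedType.Exports.
Local Open Scope classical_set_scope.
Local Open Scope ring_scope.

Section Defs.
Variable R : realType.

Definition Cset (n : nat) (X : set 'cV[R]_n) : Prop :=
  convex_set X /\ bounded_set X /\ interior X (0 : 'cV[R]_n).

Definition polyhedral (n : nat) (X : set 'cV[R]_n) : Prop :=
  exists (p : nat) (F : 'M[R]_(p, n)) (g : 'cV[R]_p),
    X = [set x | forall j : 'I_p, (F *m x) j 0 <= g j 0].

Definition Cpolytope (n : nat) (X : set 'cV[R]_n) : Prop :=
  Cset X /\ polyhedral X.

Definition extreme_point (n : nat) (X : set 'cV[R]_n) (v : 'cV[R]_n) : Prop :=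
  X v /\ forall (y z : 'cV[R]_n) (t : R), X y -> X z -> 0 < t < 1 ->
    v = t *: y + (1 - t) *: z -> y = z.

Definition vertices_of (n N : nat) (X : set 'cV[R]_n) (x : 'I_N -> 'cV[R]_n)
  : Prop :=
  injective x /\ (forall i, extreme_point X (x i)) /\
  (forall v, extreme_point X v -> exists i, v = x i).

(* an element (C, d) of M : C = col(C_1..C_N), d = col(d_1..d_N) *)
Definition policy (m l N : nat) : Type :=
  (('I_N -> 'M[R]_(m, l)) * ('I_N -> 'cV[R]_m))%type.

Definition Uset (n m N : nat) (Uc : set 'cV[R]_m) (S : set 'cV[R]_n)
  (Ad : 'M[R]_n) (Bd : 'M[R]_(n, m)) (x : 'I_N -> 'cV[R]_n)
  (u : 'I_N -> 'cV[R]_m) : Prop :=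
  forall i, Uc (u i) /\ S (Ad *m x i + Bd *m u i).

Definition apply_policy (m l N : nat) (Cd : policy m l N) (dv : 'cV[R]_l)
  : 'I_N -> 'cV[R]_m := fun i => Cd.1 i *m dv + Cd.2 i.

Definition Lset (n m l N : nat) (Uc : set 'cV[R]_m) (S : set 'cV[R]_n)
  (A : 'cV[R]_l -> 'M[R]_n) (B : 'cV[R]_l -> 'M[R]_(n, m))
  (x : 'I_N -> 'cV[R]_n) (dv : 'cV[R]_l) (Cd : policy m l N) : Prop :=
  forall i, Uc (Cd.1 i *m dv + Cd.2 i) /\
            S (A dv *m x i + B dv *m (Cd.1 i *m dv + Cd.2 i)).

Definition Lmulti (T : Type) (n m l N : nat) (emb : T -> 'cV[R]_l)
  (Uc : set 'cV[R]_m) (S : set 'cV[R]_n)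
  (A : 'cV[R]_l -> 'M[R]_n) (B : 'cV[R]_l -> 'M[R]_(n, m))
  (x : 'I_N -> 'cV[R]_n) (s : seq T) (Cd : policy m l N) : Prop :=
  foldr (fun t P => Lset Uc S A B x (emb t) Cd /\ P) True s.
End Defs.

Section Prob.
Variables (R : realType) (d : measure_display) (T : measurableType d).
Variable P : probability T R.
Local Open Scope ereal_scope.

Fixpoint iter_int (k : nat) (F : seq T -> \bar R) : \bar R :=
  match k with
  | 0 => F [::]
  | k'.+1 => \int[P]_t iter_int k' (fun s => F (t :: s))
  end.

(* P^K(E) for E a set of K-multisamples: the K-fold product probability,
   computed as the iterated integral of the indicator of E (Fubini–Tonelli;
   equal to the product measure on measurable E) *)
Definition pow_prob (K : nat) (E : set (K.-tuple T)) : \bar R :=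
  iter_int K (fun s => (\1_[set s' : seq T | exists t : K.-tuple T,
                                   tval t = s' /\ E t] s)%:E).

Definition violation (n m l N : nat) (emb : T -> 'cV[R]_l)
  (Uc : set 'cV[R]_m) (S : set 'cV[R]_n)
  (A : 'cV[R]_l -> 'M[R]_n) (B : 'cV[R]_l -> 'M[R]_(n, m))
  (x : 'I_N -> 'cV[R]_n) (Cd : policy R m l N) : \bar R :=
  P [set t : T | ~ Uset Uc S (A (emb t)) (B (emb t)) x
                       (apply_policy Cd (emb t))].
End Prob.

(* Main.v *)
Require Import Defs.
From HB Require Import structures.
From mathcomp Require Import all_boot all_order all_algebra.
From mathcomp Require Import all_classical all_reals all_analysis.
From mathcomp Require Import lra.
Import Order.TTheory GRing.Theory Num.Theory.
Import numFieldNormedType.Exports.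
Local Open Scope classical_set_scope.
Local Open Scope ring_scope.

(* The tie-break maps Theta need not be measurable, so the textbook argument --
   cover the bad event by the events F_I that the policy computed from the
   subsample I is bad but feasible for the other K - #|I| samples, and bound each
   of them by Fubini -- does not apply as it stands.  Instead P is extended to a
   finitely additive mean Lam on all bounded functions.  The iterated integral of
   an indicator is at most the iterated mean, which is additive, so it remains to
   bound the iterated mean of the indicator of each F_I.

   When a sample s outside I comes before some sample of I, means would have to be
   interchanged, which is illegitimate in general.  What is needed is this: if nu is
   a finitely additive measure on policies that is carried by the policies theta
   with P {s | theta in L_s} <= c, then the mean over s of nu(L_s) is at most c nu(1).
   It holds because the L_s are polyhedra: there is a countable family of sets (it
   depends on nu) such that finite unions of its members contained in L_s exhaust
   L_s up to small nu-mass, for all s at once.  Hence nu(L_s) is an increasing limit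
   of simple measurable functions of s, and for finite sums the interchange is legitimate. *)

Set Implicit Arguments.
Unset Strict Implicit.

(** * Finitely additive measures *)

Section FinitelyAdditive.
Variables (R : realType) (Z : Type).
Implicit Types (mu nu rho : set Z -> R) (X Y : set Z).

Definition fin_additive mu : Prop :=
  (forall X, 0 <= mu X) /\
  (forall X Y, X `&` Y = set0 -> mu (X `|` Y) = mu X + mu Y).

Lemma fin_additive0 mu : fin_additive mu -> mu set0 = 0.
Proof.
move=> [_ muU]; have := muU set0 set0 (setI0 _).
by rewrite setU0 => /eqP; rewrite -subr_eq0 opprD addrA subrr sub0r oppr_eq0 => /eqP.
Qed.

Lemma fin_additive_split mu X Y : fin_additive mu ->
  mu X = mu (X `&` Y) + mu (X `\` Y).
Proof.
move=> [_ muU]; rewrite -muU ?setUIDK//.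
by apply/seteqP; split=> // z [[_ Yz] [_ /(_ Yz)]].
Qed.

Lemma fin_additive_le mu X Y : fin_additive mu -> X `<=` Y -> mu X <= mu Y.
Proof.
move=> fmu XY; rewrite (fin_additive_split Y X fmu) setIC setIidl//.
by rewrite lerDl; case: fmu.
Qed.

Lemma fin_additive_leU mu X Y : fin_additive mu -> mu (X `|` Y) <= mu X + mu Y.
Proof.
move=> fmu; rewrite (fin_additive_split (X `|` Y) X fmu) setIC setIidl; last first.
  exact: subsetUl.
by rewrite lerD2l; apply: fin_additive_le => // z [[]].
Qed.

Lemma fin_additive_zero : fin_additive (fun=> 0).
Proof. by split => // X Y _; rewrite addr0. Qed.

Lemma fin_additiveB mu nu : fin_additive mu -> fin_additive nu ->
  (forall X, nu X <= mu X) -> fin_additive (fun X => mu X - nu X).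
Proof.
move=> [mu0 muU] [nu0 nuU] le; split=> [X|X Y XY]; first by rewrite subr_ge0.
by rewrite muU// nuU// opprD addrACA.
Qed.

Lemma fin_additive_restrict mu D : fin_additive mu ->
  fin_additive (fun X => mu (X `&` D)).
Proof.
move=> [mu0 muU]; split=> // X Y XY; rewrite setIUl muU//.
by rewrite setIACA XY set0I.
Qed.

(** Serves twice: for the mass infinitesimally close to a kernel, and for the residue of the greedy
    exhaustion. Values decrease and stay nonnegative, and additivity passes to setwise limits. *)
Lemma fin_additive_lim (rho_ : nat -> set Z -> R) :
  (forall n, fin_additive (rho_ n)) ->
  (forall n X, rho_ n.+1 X <= rho_ n X) ->
  exists2 rho, fin_additive rho &
    (forall n X, rho X <= rho_ n X) /\
    (forall X, rho_ ^~ X @ \oo --> rho X).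
Proof.
move=> frho decr.
have mono X : {homo (rho_ ^~ X) : n m / (n <= m)%N >-> m <= n}.
  by apply/nonincreasing_seqP => n; exact: decr.
have cv X : cvgn (rho_ ^~ X).
  apply: nonincreasing_is_cvgn; first exact: mono.
  by exists 0 => _ [n _ <-]; case: (frho n).
exists (fun X => limn (rho_ ^~ X)); last first.
  by split=> [n X|X]; [exact: nonincreasing_cvgn_ge | exact: cv].
split=> [X|X Y XY].
  by apply: limr_ge; [exact: cv | apply: nearW => n; case: (frho n)].
have -> : rho_ ^~ (X `|` Y) = rho_ ^~ X + rho_ ^~ Y.
  by apply/funext => n; case: (frho n) => _; apply.
by rewrite limD.
Qed.

End FinitelyAdditive.

(** * Approximation from inside by a countable family of sets *)

Section InnerApproximation.
Variables (R : realType) (Z : Type).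
Implicit Types (mu nu rho : set Z -> R) (X : set Z).

Definition cup (Y : nat -> set Z) (F : seq nat) : set Z :=
  [set t | exists2 i, i \in F & Y i t].

Lemma cup_cat (Y : nat -> set Z) (F G : seq nat) :
  cup Y (F ++ G) = cup Y F `|` cup Y G.
Proof.
apply/seteqP; split=> t /=.
  by move=> [i]; rewrite mem_cat => /orP[] iF Yi; [left|right]; exists i.
by move=> [] [i iF Yi]; exists i => //; rewrite mem_cat iF ?orbT.
Qed.

(** Unions are finite because [mu] need not be continuous along increasing unions. *)
Definition inner_approx mu (Y : nat -> set Z) (H : set Z) : Prop :=
  forall eta, 0 < eta -> exists F : seq nat,
    (forall i, i \in F -> Y i `<=` H) /\ mu (H `\` cup Y F) <= eta.

Lemma inner_approx_countable (I : countType) (Y : I -> set Z) :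
  exists Y' : nat -> set Z, forall mu (H : set Z),
    (forall eta, 0 < eta -> exists F : seq I,
      (forall i, i \in F -> Y i `<=` H) /\
      mu (H `\` [set t | exists2 i, i \in F & Y i t]) <= eta) ->
    inner_approx mu Y' H.
Proof.
exists (fun n => if unpickle n is Some i then Y i else set0) => mu H HF eta eta0.
have [F [FH Feta]] := HF _ eta0.
exists (map pickle F); split.
  by move=> _ /mapP[i iF ->]; rewrite pickleK; exact: FH.
congr (mu (H `\` _) <= eta): Feta; apply/seteqP; split=> t /=.
  by move=> [i iF Yi]; exists (pickle i); rewrite ?map_f// pickleK.
by move=> [_ /mapP[i iF ->]]; rewrite pickleK; exists i.
Qed.

(** Merges countably many families, so that approximations of different origin can be combined. *)
Lemma inner_approx_sub (I : countType) (Y_ : I -> nat -> set Z) :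
  exists Y, forall mu H i, inner_approx mu (Y_ i) H -> inner_approx mu Y H.
Proof.
have [Y HY] := inner_approx_countable (fun p : I * nat => Y_ p.1 p.2).
exists Y => nu H i HI; apply: HY => eta /HI[F [FH Feta]].
exists [seq (i, k) | k <- F]; split=> [_ /mapP[k kF ->]|]; first exact: FH.
congr (nu (H `\` _) <= eta): Feta; apply/seteqP; split=> t /=.
  by move=> [k kF Yk]; exists (i, k); rewrite ?map_f.
by move=> [_ /mapP[k kF ->]] /= Yk; exists k.
Qed.

End InnerApproximation.

(** * Countable inner approximation of polyhedra *)

Section HalfSpaces.
Variables (R : realType) (Z : Type).
Implicit Types (mu nu rho : set Z -> R) (X : set Z).

(** The coordinate map [z] is arbitrary: a drop in dimension replaces [z] by [A *m z] and leaves [Z]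
    and the measure alone. *)
Definition half (r : nat) (z : Z -> 'cV[R]_r) (l : 'rV[R]_r) : set Z :=
  [set t | 0 <= (l *m z t) 0 0].

Definition half_approx (r : nat) (z : Z -> 'cV[R]_r) mu : Prop :=
  exists Y, forall l, inner_approx mu Y (half z l).

Lemma half_approx0 r (z : Z -> 'cV[R]_r) : half_approx z (fun=> 0).
Proof. by exists (fun=> set0) => l eta eta0; exists [::]; split=> //; exact: ltW. Qed.

Lemma half_approxD r (z : Z -> 'cV[R]_r) mu nu :
  fin_additive mu -> fin_additive nu ->
  half_approx z mu -> half_approx z nu -> half_approx z (fun X => mu X + nu X).
Proof.
move=> fmu fnu [Y1 HY1] [Y2 HY2].
have [Y HY] := inner_approx_sub R (fun b : bool => if b then Y1 else Y2).
exists Y => l eta eta0; have e2 : 0 < eta / 2 by rewrite divr_gt0.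
have [F1 [F1H F1e]] := HY mu _ true (HY1 l) _ e2.
have [F2 [F2H F2e]] := HY nu _ false (HY2 l) _ e2.
exists (F1 ++ F2); split=> [i|].
  by rewrite mem_cat => /orP[]; [exact: F1H|exact: F2H].
rewrite (splitr eta); apply: lerD.
  apply: le_trans F1e; apply: fin_additive_le => //; rewrite cup_cat.
  by apply: setDS; exact: subsetUl.
apply: le_trans F2e; apply: fin_additive_le => //; rewrite cup_cat.
by apply: setDS; exact: subsetUr.
Qed.

Lemma mulmx_bound p q (M : 'M[R]_(p, q)) : exists2 C, 0 < C &
  forall (v : 'cV[R]_q) e, 0 <= e -> (forall k, `|v k 0| <= e) ->
    \sum_i `|(M *m v) i 0| <= C * e.
Proof.
exists (1 + \sum_i \sum_k `|M i k|).
  by rewrite ltr_pwDl// sumr_ge0// => i _; rewrite sumr_ge0.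
move=> v e e0 ve; rewrite mulrDl mul1r -[leLHS]add0r lerD//.
rewrite mulr_suml ler_sum// => i _; rewrite mulr_suml mxE.
apply: (le_trans (ler_norm_sum _ _ _)); apply: ler_sum => k _.
by rewrite normrM ler_wpM2l.
Qed.

Lemma rat_approx r (l : 'rV[R]_r) e : 0 < e -> exists l' : 'rV[rat]_r,
  \sum_k `|(l - map_mx ratr l') 0 k| <= e.
Proof.
move=> e0; pose d := e / r.+1%:R.
have d0 : 0 < d by rewrite divr_gt0.
have ex (k : 'I_r) : exists q : rat, `|l 0 k - ratr q| <= d.
  have lt : l 0 k - d < l 0 k + d by lra.
  have [q] := rat_in_itvoo lt; rewrite in_itv/= => /andP[q1 q2].
  by exists q; rewrite ler_distlC; apply/andP; split; lra.
have [f Hf] := choice ex.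
exists (\row_k f k).
apply: (@le_trans _ _ (\sum_(k < r) d)).
  by apply: ler_sum => k _; rewrite !mxE.
rewrite sumr_const card_ord -mulr_natr /d mulrAC ler_pdivrMr// ler_pM2l//.
by rewrite ler_nat.
Qed.

Definition near_ker (r j : nat) (z : Z -> 'cV[R]_r) (A : 'M[R]_(j, r)) (n : nat)
  : set Z := [set t | forall i, `|(A *m z t) i 0| <= n.+1%:R^-1].

(** Neighbourhoods of the kernel are used because the kernel itself may be null while all of them
    keep mass at least [e]. *)
Definition heavy r j (z : Z -> 'cV[R]_r) nu (A : 'M[R]_(j, r)) : Prop :=
  exists2 e, 0 < e & forall n, e <= nu (near_ker z A n).

Lemma near_kerS r j (z : Z -> 'cV[R]_r) (A : 'M[R]_(j, r)) n :
  near_ker z A n.+1 `<=` near_ker z A n.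
Proof.
by move=> t tn i; apply: (le_trans (tn i)); rewrite lef_pV2 ?posrE// ler_nat.
Qed.

Lemma row_free_col_mx (F : fieldType) r j (A : 'M[F]_(j, r)) (l : 'rV[F]_r) :
  row_free A -> ~~ (l <= A)%MS -> row_free (col_mx A l).
Proof.
move=> /eqP rA lA; rewrite /row_free eqn_leq rank_leq_row/= -addsmxE.
have /leqifP := mxrank_leqif_sup (addsmxSl A l).
case: ifP => [|_]; first by rewrite addsmx_sub => /andP[_ /idPn]; rewrite lA.
by rewrite rA addn1.
Qed.

(** The matrix without rows is heavy, and a row-free matrix has at most [r] rows; a heavy one with
    the most rows is taken. *)
Lemma exists_maximal_heavy r (z : Z -> 'cV[R]_r) nu :
  fin_additive nu -> 0 < nu setT ->
  exists j (A : 'M[R]_(j, r)), [/\ row_free A, heavy z nu A &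
    forall l : 'rV[R]_r, ~~ (l <= A)%MS -> ~ heavy z nu (col_mx A l)].
Proof.
move=> fnu nu0.
pose Q j := `[< exists2 A : 'M[R]_(j, r), row_free A & heavy z nu A >].
have Q0 : exists j, Q j.
  exists 0%N; apply/asboolP; exists 0; first by rewrite /row_free -leqn0 rank_leq_row.
  exists (nu setT) => // n; by apply: fin_additive_le => // t _ [].
have Qr j : Q j -> (j <= r)%N.
  by move=> /asboolP[A /eqP rA _]; rewrite -rA; exact: rank_leq_col.
case: (ex_maxnP Q0 Qr) => j /asboolP[A Af Ah] jmax.
exists j, A; split=> // l lA lh.
have : Q (j + 1)%N by apply/asboolP; exists (col_mx A l) => //; exact: row_free_col_mx.
by move=> /jmax; rewrite addn1 ltnn.
Qed.

(* Take A maximal among the matrices such that nu keeps mass arbitrarily close to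
   the kernel of A, and let mu be that infinitesimally close part of nu.  A
   functional in the row space of A factors through A, which has smaller rank; by
   maximality any other functional is bounded away from 0 off a set of small
   mu-mass, so that its half-space is approximated by rational half-spaces. *)
Lemma half_approx_piece r (z : Z -> 'cV[R]_r) nu :
  (forall t k, `|z t k 0| <= 1) ->
  (forall t, z t = 0 \/ \sum_k `|z t k 0| = 1) ->
  (forall j, (j < r)%N -> forall (z' : Z -> 'cV[R]_j) nu', fin_additive nu' ->
    half_approx z' nu') ->
  fin_additive nu -> 0 < nu setT ->
  exists mu, [/\ fin_additive mu, forall X, mu X <= nu X, 0 < mu setT &
    half_approx z mu].
Proof.
move=> z1 zn IH fnu nu0.
(* The zero vector lies in every half-space, so mass sitting there is approximated by one single
   set. *)
have [z0|z0] := ltP 0 (nu [set t | z t = 0]).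
  exists (fun X => nu (X `&` [set t | z t = 0])); split.
  - exact: fin_additive_restrict.
  - by move=> X; apply: fin_additive_le => //; exact: subIsetl.
  - by rewrite setTI.
  - exists (fun=> [set t | z t = 0]) => l eta eta0; exists [:: 0%N]; split.
      by move=> i _ t /= zt0; rewrite /half/= zt0 mulmx0 mxE.
    rewrite (_ : _ `&` _ = set0) ?fin_additive0 ?ltW//.
    by apply/seteqP; split=> // t [[_ Yt] zt0]; apply: Yt; exists 0%N.
have [j [A [Af [e e0 Ah] Amax]]] := exists_maximal_heavy z fnu nu0.
(* If [A] were invertible, points close enough to its kernel would have norm below 1, hence
   [z t = 0] by normalisation; that set is null, against heaviness. *)
have jr : (j < r)%N.
  rewrite ltn_neqAle -{2}(eqP Af) rank_leq_col andbT; apply/negP => /eqP jr.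
  subst j; have Au : A \in unitmx by rewrite -row_free_unit.
  have [C C0 HC] := mulmx_bound (invmx A).
  have [n nC] : exists n : nat, C < n.+1%:R.
    by exists (Num.truncn C); exact: truncnS_gt.
  have := Ah n; apply/negP; rewrite -ltNge.
  apply: le_lt_trans e0; apply: le_trans z0; apply: fin_additive_le => // t tn /=.
  have [//|zt1] := zn t.
  have := HC (A *m z t) n.+1%:R^-1; rewrite mulKmx// zt1 => /(_ _ tn).
  by rewrite invr_ge0 ler0n => /(_ isT); rewrite leNgt ltr_pdivrMr// mul1r nC.
have [mu fmu [mule mucv]] := fin_additive_lim
  (fun n => fin_additive_restrict (near_ker z A n) fnu)
  (fun n X => fin_additive_le fnu (setIS (@near_kerS r j z A n))).
have munu X : mu X <= nu X.
  by apply: (le_trans (mule 0%N X)); apply: fin_additive_le => //; exact: subIsetl.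
exists mu; split=> //.
  apply: lt_le_trans e0 _; apply: (closed_cvg _ (@closed_ge R e)) (mucv setT) => //.
  by apply: nearW => n /=; rewrite setTI; exact: Ah.
have [Y1 HY1] := IH j jr (fun t => A *m z t) mu fmu.
have [Y2 HY2] := inner_approx_countable R (fun p : 'rV[rat]_r * nat =>
  [set t | p.2.+1%:R^-1 <= (map_mx ratr p.1 *m z t) 0 0]).
have [Y HY] := inner_approx_sub R (fun b : bool => if b then Y1 else Y2).
exists Y => l; have [/submxP[D lDA]|lA] := boolP (l <= A)%MS.
  apply: (HY _ _ true); rewrite (_ : half z l = half (fun t => A *m z t) D).
    exact: HY1.
  by rewrite /half lDA; apply/seteqP; split=> t /=; rewrite mulmxA.
apply: (HY _ _ false); apply: HY2 => eta eta0.
(* By maximality, [mu] almost lives where [l *m z t] has absolute value above [d]. *)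
have [n neta] : exists n, nu (near_ker z (col_mx A l) n) <= eta.
  apply: contrapT => /forallNP H; apply: (Amax l lA); exists eta => // n.
  by apply/ltW; rewrite ltNge; exact/negP.
pose d : R := n.+1%:R^-1; have d0 : 0 < d by rewrite invr_gt0.
have [l' ll'] := rat_approx l (divr_gt0 d0 (ltr0Sn R 1)).
have close t : `|(l *m z t) 0 0 - (map_mx ratr l' *m z t) 0 0| <= d / 2.
  have -> : (l *m z t) 0 0 - (map_mx ratr l' *m z t) 0 0 =
      ((l - map_mx ratr l') *m z t) 0 0 by rewrite mulmxBl !mxE.
  apply: le_trans ll'; rewrite mxE; apply: (le_trans (ler_norm_sum _ _ _)).
  by apply: ler_sum => k _; rewrite normrM ler_piMr.
have dd : (n.*2.+1).+1%:R^-1 = d / 2.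
  by rewrite -doubleS -muln2 natrM invfM.
(* The index [n.*2.+1] encodes the threshold [d / 2]. Since [l'] is [d / 2]-close to [l], reaching
   the threshold forces [l *m z t] to be nonnegative, and missing it inside the half-space forces it
   to be at most [d]. *)
exists [:: (l', n.*2.+1)]; split.
  move=> _ /[!inE] /eqP -> t; rewrite /half /= dd => lt.
  by have := close t; rewrite ler_norml => /andP[c1 c2]; lra.
apply: (le_trans (mule n _)); apply: le_trans neta.
apply: fin_additive_le => // t [[Hl Yt] tn] i.
rewrite mul_col_mx mxE; case: splitP => k _; first exact: tn.
rewrite (ord1 k) ger0_norm// -/d; rewrite leNgt; apply/negP => dl.
apply: Yt; exists (l', n.*2.+1); rewrite ?inE//= dd.
by have := close t; rewrite ler_norml => /andP[c1 c2]; lra.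
Qed.

End HalfSpaces.

(** * Exhaustion by approximable pieces, and passage to all polyhedra *)

Section Exhaustion.
Variables (R : realType) (Z : Type).
Implicit Types (mu nu rho : set Z -> R) (X : set Z).

Definition half_approx_below r (z : Z -> 'cV[R]_r) rho mu : Prop :=
  [/\ fin_additive mu, forall X, mu X <= rho X & half_approx z mu].

(** The supremum of the masses need not be attained, hence the factor 2; when it vanishes the zero
    piece will do. *)
Lemma exists_half_maximal_piece r (z : Z -> 'cV[R]_r) rho : fin_additive rho ->
  exists2 mu, half_approx_below z rho mu &
    forall mu', half_approx_below z rho mu' -> mu' setT <= 2 * mu setT.
Proof.
move=> frho; pose E := [set mu setT | mu in half_approx_below z rho].
have E0 : E 0.
  exists (fun=> 0) => //; split; [exact: fin_additive_zero| |exact: half_approx0].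
  by case: frho.
have Esup : has_sup E.
  split; first by exists 0.
  by exists (rho setT) => _ [mu [_ le _] <-].
have [sup0|sup0] := ltP 0 (sup E).
  have [_ [mu mub <-] lt] := sup_adherent (divr_gt0 sup0 (ltr0Sn R 1)) Esup.
  exists mu => // mu' mub'.
  have : mu' setT <= sup E by apply: (ub_le_sup (proj2 Esup)); exists mu'.
  lra.
exists (fun=> 0).
  split; [exact: fin_additive_zero| |exact: half_approx0].
  by case: frho.
move=> mu' mub'; rewrite mulr0; apply: le_trans sup0.
by apply: (ub_le_sup (proj2 Esup)); exists mu'.
Qed.

(* Greedy exhaustion: subtract again and again a piece of at least half the
   largest possible mass; a residue of positive mass would contain a piece that
   every step has overlooked. *)
Lemma half_approx_exhaust r (z : Z -> 'cV[R]_r) nu :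
  (forall rho, fin_additive rho -> 0 < rho setT ->
    exists2 mu, half_approx_below z rho mu & 0 < mu setT) ->
  fin_additive nu -> half_approx z nu.
Proof.
move=> pieces fnu.
have ex rho : exists mu, fin_additive rho -> half_approx_below z rho mu /\
    forall mu', half_approx_below z rho mu' -> mu' setT <= 2 * mu setT.
  have [frho|nf] := pselect (fin_additive rho); last by exists rho.
  by have [mu ? ?] := exists_half_maximal_piece z frho; exists mu.
have [pick Hpick] := choice ex.
pose rho_ n := iter n (fun rho X => rho X - pick rho X) nu.
have frho n : fin_additive (rho_ n).
  elim: n => //= n IH; have [[fp ple _] _] := Hpick _ IH.
  exact: fin_additiveB.
have decr n X : rho_ n.+1 X <= rho_ n X.
  by have [[[p0 _] _ _] _] := Hpick _ (frho n); rewrite /= lerBlDr lerDl.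
have [rho frho' [rhole rhocv]] := fin_additive_lim frho decr.
have rho0 : rho setT = 0.
  apply/eqP; rewrite eq_le; case: (frho') => -> _; rewrite andbT leNgt.
  apply/negP => rho0; have [mu [fmu mule hmu] mu0] := pieces _ frho' rho0.
  (* [mu] lies below every residue, so it competes at every step; but the masses removed tend to
     0. *)
  have picked n : mu setT / 2 <= rho_ n setT - rho_ n.+1 setT.
    have [_ pmax] := Hpick _ (frho n).
    have := pmax mu; rewrite /= opprB addrC subrK => H.
    have {}H : mu setT <= 2 * pick (rho_ n) setT.
      by apply: H; split=> // X; exact: le_trans (mule X) (rhole n X).
    lra.
  have cv0 : (fun n => rho_ n setT - rho_ n.+1 setT) @ \oo --> rho setT - rho setT.
    apply: cvgB; first exact: rhocv.
    by rewrite (cvg_shiftS (fun n => rho_ n setT)); exact: rhocv.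
  have : mu setT / 2 <= rho setT - rho setT.
    apply: (closed_cvg _ (@closed_ge R (mu setT / 2))) cv0 => //.
    by apply: nearW => n; exact: picked.
  lra.
(* The difference is the sum of the first [n] pieces. *)
have sum n : half_approx z (fun X => nu X - rho_ n X) /\
    (forall X, rho_ n X <= nu X).
  elim: n => [|n [IH le]]; split=> //=.
  - by rewrite (_ : (fun X => _) = fun=> 0);
      [exact: half_approx0|apply/funext => X; rewrite subrr].
  - have [[fp _ hp] _] := Hpick _ (frho n).
    rewrite (_ : (fun X => _) = fun X => (nu X - rho_ n X) + pick (rho_ n) X).
      by apply: half_approxD => //; exact: fin_additiveB.
    by apply/funext => X; rewrite opprB addrA addrAC.
  - by move=> X; apply: le_trans (decr n X) (le X).
have [Y_ HY_] := choice (fun n => (sum n).1).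
have [Y HY] := inner_approx_sub R Y_.
exists Y => l eta eta0; have e2 : 0 < eta / 2 by rewrite divr_gt0.
have [n rn] : exists n, rho_ n setT <= eta / 2.
  have := rhocv setT; rewrite rho0 => /cvgrPdist_le /(_ _ e2)[n _ /(_ n (leqnn n))].
  by rewrite sub0r normrN ger0_norm; [exists n|case: (frho n)].
have [F [FH Fe]] := HY _ _ n (HY_ n l) _ e2.
exists F; split=> //; rewrite -[leLHS](subrK (rho_ n (half z l `\` cup Y F))).
rewrite (splitr eta) lerD//; apply: le_trans rn.
exact: fin_additive_le.
Qed.

(** Homogeneous half-spaces ignore positive scaling, so coordinates may be put on the unit sphere of
    the 1-norm; the zero vector stays fixed. *)
Lemma half_normalise r (v : 'cV[R]_r) (w := (\sum_k `|v k 0|)^-1 *: v) :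
  [/\ forall k, `|w k 0| <= 1, w = 0 \/ \sum_k `|w k 0| = 1 &
    forall l : 'rV[R]_r, (0 <= (l *m w) 0 0) = (0 <= (l *m v) 0 0)].
Proof.
rewrite /w; set s := \sum_k _.
have s_ge0 : 0 <= s by exact: sumr_ge0.
have vs k : `|v k 0| <= s.
  by rewrite /s (bigD1 k)//= lerDl sumr_ge0.
have [s0|s0] := eqVneq s 0.
  have v0 : v = 0.
    apply/matrixP => k c; rewrite ord1 mxE; apply/eqP.
    by rewrite -normr_le0 -s0.
  rewrite v0 scaler0; split=> [k||l]; rewrite ?mulmx0//; last by left.
  by rewrite mxE normr0.
have sp : 0 < s by rewrite lt_def s0.
split=> [k||l].
- by rewrite mxE normrM normfV (ger0_norm s_ge0) mulrC ler_pdivrMr// mul1r.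
- right; under eq_bigr do rewrite mxE normrM normfV (ger0_norm s_ge0).
  by rewrite -mulr_sumr mulVf.
- by rewrite -scalemxAr mxE pmulr_rge0// invr_gt0.
Qed.

(** Strong induction on the dimension: lower dimensions supply the pieces, and exhaustion assembles
    them. *)
Lemma half_approx_all r (z : Z -> 'cV[R]_r) nu :
  fin_additive nu -> half_approx z nu.
Proof.
elim/ltn_ind: r => r IH in z nu *; move=> fnu.
pose w t := (\sum_k `|z t k 0|)^-1 *: z t.
have halfE l : half w l = half z l.
  by apply/seteqP; split=> t; rewrite /half/= (let: And3 _ _ H := half_normalise (z t) in H).
suff [Y HY] : half_approx w nu by exists Y => l; rewrite -halfE.
apply: half_approx_exhaust fnu => rho frho rho0.
have [|||mu [fmu mule mu0 hmu]] := @half_approx_piece R Z r w rho _ _ _ frho rho0.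
- by move=> t; case: (half_normalise (z t)).
- by move=> t; case: (half_normalise (z t)).
- by move=> j jr z' nu'; exact: IH.
- by exists mu.
Qed.

Definition polyh r (z : Z -> 'cV[R]_r) (ls : seq 'rV[R]_r) : set Z :=
  [set t | forall l, l \in ls -> 0 <= (l *m z t) 0 0].

(** Finite intersections of members of a family for half-spaces are again countably many; the errors
    of the facets add up. *)
Lemma polyh_approx r (z : Z -> 'cV[R]_r) nu : fin_additive nu ->
  exists Y, forall ls, inner_approx nu Y (polyh z ls).
Proof.
move=> fnu; have [Y HY] := half_approx_all z fnu.
have [Y' HY'] := inner_approx_countable R
  (fun s : seq nat => [set t | forall i, i \in s -> Y i t]).
exists Y' => ls; apply: HY'.
elim: ls => [|l ls IH] eta eta0.
  exists [:: [::]]; split=> [s _ t _ //|].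
  rewrite (_ : _ `\` _ = set0) ?fin_additive0 ?ltW//.
  by apply/seteqP; split=> // t [_]; apply; exists [::]; rewrite ?inE.
have e2 : 0 < eta / 2 by rewrite divr_gt0.
have [F [FH Fe]] := HY l _ e2; have [G [GH Ge]] := IH _ e2.
exists [seq i :: s | i <- F, s <- G]; split.
  move=> _ /allpairsP[[i s] [/= iF sG ->]] t Yt l'.
  rewrite inE => /predU1P[->|l'ls]; first by apply: (FH i iF); apply: Yt; rewrite inE eqxx.
  by apply: (GH s sG) => // k ks; apply: Yt; rewrite inE ks orbT.
rewrite (splitr eta); apply: le_trans (lerD Fe Ge).
apply: le_trans (fin_additive_leU _ _ fnu); apply: fin_additive_le => // t [Ht Yt].
apply: contrapT => /not_orP[] /not_andP nF /not_andP nG; apply: Yt.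
have [i iF Yi] : cup Y F t.
  by case: nF => [[]|/contrapT//]; apply: Ht; rewrite inE eqxx.
have [s sG Ys] : [set t | exists2 s, s \in G & (forall i, i \in s -> Y i t)] t.
  by case: nG => [[]|/contrapT//]; move=> l' l'ls; apply: Ht; rewrite inE l'ls orbT.
exists (i :: s); first by apply/allpairsP; exists (i, s).
by move=> k; rewrite inE => /predU1P[->|/Ys].
Qed.

End Exhaustion.

(** * Finitely additive extension of a probability *)

Section BoundedFunctions.
Variable R : realType.

Definition bounded_fct (S : Type) (f : S -> R) : Prop :=
  exists M, forall t, `|f t| <= M.

Lemma bounded_indic (S : Type) (A : set S) : bounded_fct (\1_A : S -> R).
Proof. by exists 1 => t; rewrite indicE normr_nat lern1 leq_b1. Qed.

Lemma bounded_cst (S : Type) (c : R) : bounded_fct (fun _ : S => c).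
Proof. by exists `|c|. Qed.

Lemma bounded_add (S : Type) (f g : S -> R) :
  bounded_fct f -> bounded_fct g -> bounded_fct (fun t => f t + g t).
Proof.
move=> [M fM] [N gN]; exists (M + N) => t.
by apply: (le_trans (ler_normD _ _)); exact: lerD.
Qed.

Lemma bounded_scale (S : Type) (c : R) (f : S -> R) :
  bounded_fct f -> bounded_fct (fun t => c * f t).
Proof. by move=> [M fM]; exists (`|c| * M) => t; rewrite normrM ler_wpM2l. Qed.

Lemma bounded_sum (S I : Type) (r : seq I) (Q : pred I) (f : I -> S -> R) :
  (forall i, bounded_fct (f i)) ->
  bounded_fct (fun t => \sum_(i <- r | Q i) f i t).
Proof.
move=> bf; elim: r => [|i r IH].
  by exists 0 => t; rewrite big_nil normr0.
have [M HM] := IH; have [N HN] := bf i; exists (N + M) => t.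
rewrite big_cons; case: ifP => _.
  by apply: (le_trans (ler_normD _ _)); exact: lerD.
by apply: (le_trans (HM t)); rewrite lerDr; exact: le_trans (normr_ge0 _) (HN t).
Qed.

End BoundedFunctions.

Section Mean.
Context (R : realType) (d : measure_display) (T : measurableType d).
Variable P : probability T R.
Implicit Types (f g : T -> R) (B D : set T).

Definition is_mean (Lam : (T -> R) -> R) : Prop :=
  [/\ forall f g, bounded_fct f -> bounded_fct g ->
        Lam (fun t => f t + g t) = Lam f + Lam g,
      forall c f, bounded_fct f -> Lam (fun t => c * f t) = c * Lam f,
      forall f g, bounded_fct f -> bounded_fct g -> (forall t, f t <= g t) ->
        Lam f <= Lam g &
      forall B, measurable B -> (Lam \1_B)%:E = P B].

Definition point_average D (lam : (T -> R) -> R) : Prop :=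
  [/\ forall f g, lam (fun t => f t + g t) = lam f + lam g,
      forall c f, lam (fun t => c * f t) = c * lam f &
      forall f g, (forall t, D t -> f t <= g t) -> lam f <= lam g].

Lemma point_average_eq D lam f g : point_average D lam ->
  (forall t, D t -> f t = g t) -> lam f = lam g.
Proof.
move=> [_ _ mono] fg; apply/eqP; rewrite eq_le.
by apply/andP; split; apply: mono => t Dt; rewrite fg.
Qed.

(** [D] is cut successively along the sets of [Bs]; each nonempty final cell contributes the value
    at one of its points, weighted by the probability of the cell. *)
Lemma exists_point_average (Bs : seq (set T)) D : measurable D ->
  {in Bs, forall B, measurable B} ->
  exists lam, [/\ point_average D lam, (lam (cst 1))%:E = P D &
    {in Bs, forall B, (lam \1_B)%:E = P (B `&` D)}].
Proof.
elim: Bs D => [|B Bs IH] D mD mBs.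
  have [->|/set0P[t0 Dt0]] := eqVneq D set0.
    exists (fun=> 0); split=> //; last by rewrite measure0.
    by split=> // *; rewrite ?addr0 ?mulr0.
  exists (fun f => fine (P D) * f t0); split=> //.
    split=> [f g|c f|f g fg]; [by rewrite mulrDr|by rewrite mulrCA|].
    by apply: ler_wpM2l; [exact: fine_ge0|exact: fg].
  by rewrite mulr1 fineK// fin_num_measure.
have mB : measurable B by apply: mBs; rewrite inE eqxx.
have mBs' : {in Bs, forall B, measurable B}.
  by move=> C CBs; apply: mBs; rewrite inE CBs orbT.
have [l1 [[a1 h1 m1] e1 b1]] := IH _ (measurableI _ _ mD mB) mBs'.
have [l2 [[a2 h2 m2] e2 b2]] := IH _ (measurableD mD mB) mBs'.
exists (fun f => l1 f + l2 f); split.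
- split=> [f g|c f|f g fg]; first by rewrite a1 a2 addrACA.
    by rewrite h1 h2 mulrDr.
  by apply: lerD; [apply: m1 => t []|apply: m2 => t []] => *; exact: fg.
- by rewrite EFinD e1 e2 addeC -measureDI.
move=> C; rewrite inE => /predU1P[->|CBs].
  rewrite (@point_average_eq (D `&` B) l1 _ (cst 1))//; last first.
    by move=> t [_ Bt]; rewrite indicE mem_set.
  rewrite (@point_average_eq (D `\` B) l2 _ (fun t => 0 * cst 1 t))//; last first.
    by move=> t [_ Bt]; rewrite indicE memNset// mul0r.
  by rewrite h2 mul0r addr0 e1 setIC.
rewrite EFinD b1// b2// addeC.
rewrite (measureDI P (measurableI _ _ (mBs' _ CBs) mD) mB).
by rewrite setIDA setIA.
Qed.

Lemma ultra_cvg_bounded (S : Type) (U : set_system S) (f : S -> R) (M : R) :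
  UltraFilter U -> U [set s | `|f s| <= M] -> exists l : R, f @ U --> l.
Proof.
move=> UU UM.
have UF : UltraFilter (f @ U).
  apply: Build_UltraFilter => G GF UG; apply/seteqP; split=> // A GA.
  case: (in_ultra_setVsetC (f @^-1` A) UU) => // UC.
  have : G (A `&` ~` A) by apply: filterI => //; apply: UG.
  by rewrite setICr => /filter_ex[].
have := @segment_compact R (- M) M; rewrite compact_ultra /= => /(_ _ UF) H.
have [|l [_ fl]] := H; last by exists l.
by rewrite /nbhs/=; apply: filterS UM => s /=; rewrite in_itv/= -ler_norml.
Qed.

(** Finitely many prescribed values of [P] are met by a point average. [Lam] is the limit along an
    ultrafilter containing all these constraints; on bounded functions it exists by compactness and
    inherits linearity and monotonicity. *)
Lemma exists_mean : exists Lam, is_mean Lam.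
Proof.
pose avg B := [set lam | point_average setT lam /\
  (lam (cst 1) = 1 /\ (lam \1_B)%:E = P B)].
have FI : finI (measurable : set (set T)) avg.
  move=> D' D'm.
  have [|lam [pl l1 lB]] :=
      @exists_point_average (finmap.enum_fset D') setT measurableT.
    by move=> B /D'm /set_mem.
  exists lam => B /= BD'; split=> //; split; last by rewrite lB// setIT.
  by apply: EFin_inj; rewrite l1 probability_setT.
have PF := finI_filter FI.
have [U [UU sub]] := ultraFilterLemma PF.
have Uavg B : measurable B -> U (avg B).
  by move=> mB; apply: sub; exists (avg B) => //; exact: finI_from1.
have UT := Uavg _ measurableT.
have ex f : exists l : R, bounded_fct f -> (fun lam => lam f) @ U --> l.
  have [[M fM]|nb] := pselect (bounded_fct f); last by exists 0.
  have [|l fl] := @ultra_cvg_bounded _ U (fun lam => lam f) M UU; last by exists l.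
  apply: filterS UT => lam [[_ h mono] [l1 _]] /=.
  have lM c : lam (fun=> c) = c.
    by rewrite -[RHS]mulr1 -l1 -h; congr (lam _); apply/funext => t; rewrite /= mulr1.
  rewrite ler_norml -{1}(lM (- M)) -{2}(lM M).
  by apply/andP; split; apply: mono => t _; have := fM t; rewrite ler_norml => /andP[].
have [Lam HLam] := choice ex.
have uniq (h : ((T -> R) -> R) -> R) (a b : R) : h @ U --> a -> h @ U --> b -> a = b.
  by move=> ha hb; rewrite -(cvg_lim _ ha)// -(cvg_lim _ hb).
exists Lam; split.
- move=> f g bf bg; apply: (uniq (fun lam => lam (fun t => f t + g t))).
    exact/HLam/bounded_add.
  apply: cvg_trans (cvgD (HLam f bf) (HLam g bg)); apply: near_eq_cvg.
  by apply: filterS UT => lam [[a _ _] _] /=; rewrite a.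
- move=> c f bf; apply: (uniq (fun lam => lam (fun t => c * f t))).
    exact/HLam/bounded_scale.
  apply: cvg_trans (@cvgMl_tmp _ _ _ _ _ c _ (HLam f bf)); apply: near_eq_cvg.
  by apply: filterS UT => lam [[_ h _] _] /=; rewrite h.
- move=> f g bf bg fg; rewrite -subr_ge0.
  apply: (closed_cvg _ (@closed_ge R 0)) (cvgB (HLam g bg) (HLam f bf)).
  apply: filterS UT => lam [[_ _ m] _] /=; rewrite subr_ge0.
  by apply: m => t _; exact: fg.
- move=> B mB; have bB := @bounded_indic R T B.
  rewrite -[RHS]fineK ?fin_num_measure//; congr (_ %:E).
  apply: (uniq _ _ _ (HLam _ bB)).
  apply: cvg_near_cst.
  by apply: filterS (Uavg B mB) => lam [_ [_ /= <-]].
Qed.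

End Mean.

(** * Iterated means and their comparison with iterated integrals *)

Section MeanContent.
Context (R : realType) (d : measure_display) (T : measurableType d).
Variables (P : probability T R) (Lam : (T -> R) -> R).
Hypothesis HLam : is_mean P Lam.

Lemma mean_cst (c : R) : Lam (fun=> c) = c.
Proof.
have [_ LZ _ LP] := HLam.
have L1 : Lam \1_[set: T] = 1 by apply: EFin_inj; rewrite LP// probability_setT.
rewrite -[RHS]mulr1 -L1 -LZ; last exact: bounded_indic.
by congr (Lam _); apply/funext => t; rewrite indicT mulr1.
Qed.

Lemma mean_sum (I : Type) (r : seq I) (Q : pred I) (f : I -> T -> R) :
  (forall i, bounded_fct (f i)) ->
  Lam (fun t => \sum_(i <- r | Q i) f i t) = \sum_(i <- r | Q i) Lam (f i).
Proof.
have [LD _ _ _] := HLam; move=> bf; elim: r => [|i r IH].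
  rewrite big_nil -[RHS](mean_cst 0); congr (Lam _).
  by apply/funext => t; rewrite big_nil.
rewrite big_cons -IH; case: ifP => Qi.
  rewrite -LD//; last exact: bounded_sum.
  by congr (Lam _); apply/funext => t; rewrite big_cons Qi.
by congr (Lam _); apply/funext => t; rewrite big_cons Qi.
Qed.

Import HBNNSimple.

(* The library integral of a nonnegative function is the supremum over the
   simple functions below it, so no measurability is needed here. *)
Lemma integral_le_mean (F : T -> \bar R) (f : T -> R) :
  (forall t, 0 <= F t)%E -> (forall t, F t <= (f t)%:E)%E -> bounded_fct f ->
  (\int[P]_t F t <= (Lam f)%:E)%E.
Proof.
have [_ LZ Lmono LP] := HLam.
move=> F0 Ff bf; rewrite ge0_integralTE//; apply: ge_ereal_sup => _ [h hF <-].
rewrite sintegralE fsbig_finite//=.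
rewrite (eq_bigr (fun x => (Lam (fun t => x * \1_(h @^-1` [set x]) t))%:E)); last first.
  by move=> x _; rewrite LZ ?EFinM ?LP//; exact: bounded_indic.
rewrite sumEFin lee_fin -mean_sum; last by move=> x; apply: bounded_scale; exact: bounded_indic.
apply: Lmono => //.
  by apply: bounded_sum => x; apply: bounded_scale; exact: bounded_indic.
move=> t; rewrite -lee_fin; apply: le_trans (Ff t); apply: le_trans (hF t).
by rewrite lee_fin [leRHS]fimfunE fsbig_finite.
Qed.

Fixpoint mean_iter (k : nat) (f : seq T -> R) : R :=
  if k is k'.+1 then Lam (fun t => mean_iter k' (fun s => f (t :: s)))
  else f [::].

Lemma bounded_mean (f : T -> R) M : (forall t, `|f t| <= M) -> `|Lam f| <= M.
Proof.
have [_ _ Lmono _] := HLam; move=> fM; have bf : bounded_fct f by exists M.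
rewrite ler_norml -{1}(mean_cst (- M)) -{2}(mean_cst M).
by apply/andP; split; apply: Lmono => //; try exact: bounded_cst;
  move=> t; have := fM t; rewrite ler_norml => /andP[].
Qed.

Lemma mean_iter_bounded k (f : seq T -> R) M :
  (forall s, `|f s| <= M) -> `|mean_iter k f| <= M.
Proof.
by elim: k f => [|k IH] f fM //=; apply: bounded_mean => t; exact: IH.
Qed.

Lemma bounded_mean_iter k (f : seq T -> R) : bounded_fct f ->
  bounded_fct (fun t => mean_iter k (fun s => f (t :: s))).
Proof. by move=> [M fM]; exists M => t; apply: mean_iter_bounded. Qed.

Lemma bounded_cons (f : seq T -> R) t : bounded_fct f ->
  bounded_fct (fun s => f (t :: s)).
Proof. by move=> [M fM]; exists M. Qed.

Lemma mean_iterD k (f g : seq T -> R) : bounded_fct f -> bounded_fct g ->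
  mean_iter k (fun s => f s + g s) = mean_iter k f + mean_iter k g.
Proof.
have [LD _ _ _] := HLam.
elim: k f g => [//|k IH] f g bf bg /=.
rewrite -LD; try exact: bounded_mean_iter.
by congr (Lam _); apply/funext => t; apply: IH; exact: bounded_cons.
Qed.

Lemma mean_iter_le k (f g : seq T -> R) : bounded_fct f -> bounded_fct g ->
  (forall s, size s = k -> f s <= g s) -> mean_iter k f <= mean_iter k g.
Proof.
have [_ _ Lmono _] := HLam.
elim: k f g => [|k IH] f g bf bg fg /=; first exact: fg.
apply: Lmono; try exact: bounded_mean_iter.
move=> t; apply: IH; try exact: bounded_cons.
by move=> s sk; apply: fg; rewrite /= sk.
Qed.

Lemma mean_iter_cst k (c : R) : mean_iter k (fun=> c) = c.
Proof.
elim: k => [//|k IH] /=; rewrite -[RHS]mean_cst; congr (Lam _).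
exact/funext.
Qed.

Lemma mean_iter_sum k (I : Type) (r : seq I) (Q : pred I) (f : I -> seq T -> R) :
  (forall i, bounded_fct (f i)) ->
  mean_iter k (fun t => \sum_(i <- r | Q i) f i t) =
  \sum_(i <- r | Q i) mean_iter k (f i).
Proof.
move=> bf; elim: r => [|i r IH].
  rewrite big_nil -[RHS](mean_iter_cst k 0); congr (mean_iter k _).
  by apply/funext => t; rewrite big_nil.
rewrite big_cons -IH; case: ifP => Qi.
  rewrite -mean_iterD//; last exact: bounded_sum.
  by congr (mean_iter k _); apply/funext => t; rewrite big_cons Qi.
by congr (mean_iter k _); apply/funext => t; rewrite big_cons Qi.
Qed.

Lemma iter_int_le_mean k (F : seq T -> \bar R) (f : seq T -> R) :
  (forall s, 0 <= F s)%E -> (forall s, F s <= (f s)%:E)%E -> bounded_fct f ->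
  (0 <= iter_int P k F)%E /\ (iter_int P k F <= (mean_iter k f)%:E)%E.
Proof.
elim: k F f => [|k IH] F f F0 Ff bf /=; first by split.
split.
  apply: integral_ge0 => t _.
  by case: (IH (fun s => F (t :: s)) _ _ _ (bounded_cons t bf)).
apply: integral_le_mean; last exact: bounded_mean_iter.
  by move=> t; case: (IH (fun s => F (t :: s)) _ _ _ (bounded_cons t bf)).
by move=> t; case: (IH (fun s => F (t :: s)) _ _ _ (bounded_cons t bf)).
Qed.

End MeanContent.

(** * Random polyhedra *)

Lemma fin_additive_partition (R : realType) (Z : Type) (nu : set Z -> R)
    (W : finType) (kappa : Z -> W) (X : set Z) : fin_additive nu ->
  nu X = \sum_(w : W) nu (X `&` [set t | kappa t = w]).
Proof.
move=> fnu.
have key (s : seq W) : uniq s -> nu (X `&` [set t | kappa t \in s]) =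
    \sum_(w <- s) nu (X `&` [set t | kappa t = w]).
  elim: s => [_|w s IH /= /andP[ws us]].
    rewrite big_nil -(fin_additive0 fnu); congr nu.
    by apply/seteqP; split=> // t [].
  rewrite big_cons -IH//; case: fnu => _ <-; last first.
    by apply/seteqP; split=> // t [[_ /= ->] [_]] /=; apply/negP.
  congr nu; apply/seteqP; split=> t /=.
    by move=> [Xt]; rewrite inE => /predU1P[|]; [left|right].
  by move=> [] [Xt kt]; split; rewrite // inE; [rewrite kt eqxx|rewrite kt orbT].
rewrite -key ?index_enum_uniq//; congr nu; apply/seteqP; split=> t /=.
  by split=> //; rewrite mem_index_enum.
by case.
Qed.

Section RandomPolyhedron.
Context (R : realType) (d : measure_display) (T : measurableType d).
Variables (P : probability T R) (Lam : (T -> R) -> R).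
Hypothesis HLam : is_mean P Lam.
Variables (Z : Type) (r : nat) (z : Z -> 'cV[R]_r) (ls : T -> seq 'rV[R]_r).
Let L (s : T) : set Z := polyh z (ls s).
Let G (th : Z) : set T := [set s | L s th].
Hypothesis mG : forall th, measurable (G th).

(* Polyhedra are closed, so Y may be replaced by a countable dense subset. *)
Lemma measurable_subset_polyh (Y : set Z) : measurable [set s | Y `<=` L s].
Proof.
pose close (p : 'rV[rat]_r * nat) th :=
  \sum_k `|((z th)^T - map_mx ratr p.1) 0 k| <= p.2.+1%:R^-1.
(* Each rational ball that meets [Y] contributes [G th] for one chosen point [th] of [Y] in it; the
   others contribute no constraint. *)
have ex p : exists W : set T, measurable W /\
    ((exists th, [/\ Y th, close p th & W = G th]) \/
     ((forall th, Y th -> ~ close p th) /\ W = setT)).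
  have [[th [Yth cth]]|/forallNP H] := pselect (exists th, Y th /\ close p th).
    by exists (G th); split=> //; left; exists th.
  exists setT; split=> //; right; split=> // th Yth cth.
  by apply: (H th).
have [W HW] := choice ex.
rewrite (_ : [set s | _] =
    \bigcap_n (if unpickle n is Some p then W p else setT)); last first.
  apply/seteqP; split=> [s Ys n _|s Ws th Yth].
    case: (unpickle n) => // p.
    by case: (HW p) => _ [[th [Yth _ ->]]|[_ ->]] //; exact: Ys.
  move=> l lls; rewrite leNgt; apply/negP => neg.
  have [C C0 HC] := mulmx_bound l.
  pose e : R := - (l *m z th) 0 0.
  have e0 : 0 < e by rewrite oppr_gt0.
  (* Two points of one ball differ by at most [2 / n.+1] in each coordinate. This [n] keeps [l]
     negative at the chosen point too, which contradicts its feasibility. *)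
  have [n nC] : exists n : nat, 2 * C / e < n.+1%:R.
    by exists (Num.truncn (2 * C / e)); exact: truncnS_gt.
  have n0 : 0 < n.+1%:R^-1 :> R by rewrite invr_gt0.
  have [q qth] := rat_approx (z th)^T n0.
  case: (HW (q, n)) => _ [[th' [Yth' cth' Wp]]|[H _]]; last exact: (H th).
  have := Ws (pickle (q, n)) I; rewrite pickleK Wp => /(_ l lls) pos.
  have entry (v : Z) k : close (q, n) v -> `|z v k 0 - ratr (q 0 k)| <= n.+1%:R^-1.
    apply: le_trans; rewrite (bigD1 k)//= !mxE lerDl.
    by apply: sumr_ge0.
  have := HC (z th' - z th) (2 / n.+1%:R); rewrite big_ord1 mulmxBr !mxE.
  have -> : 0 <= 2 / n.+1%:R :> R by rewrite divr_ge0.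
  move=> /(_ isT) H.
  have {}H : `|(l *m z th') 0 0 - (l *m z th) 0 0| <= C * (2 / n.+1%:R).
    rewrite [X in `|X - _|]mxE [X in `|_ - X|]mxE; apply: H => k; rewrite !mxE.
    have a1 := entry th' k cth'; have a2 := entry th k qth.
    rewrite -(subrKA (ratr (q 0 k))); apply: (le_trans (ler_normD _ _)).
    rewrite mulr_natl mulr2n; apply: lerD => //.
    by rewrite distrC.
  have Ce : C * (2 / n.+1%:R) < e.
    by rewrite mulrA ltr_pdivrMr// mulrC (mulrC e) -ltr_pdivrMr.
  move: H; rewrite ler_norml => /andP[_ /le_lt_trans /(_ Ce)].
  by rewrite ltrBlDr addNr ltNge pos.
apply: bigcapT_measurable => n; case: (unpickle n) => [p|//].
by case: (HW p).
Qed.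

Lemma mean_content_le (nu : set Z -> R) (c : R) :
  fin_additive nu -> 0 <= c ->
  nu [set th | ~ (P (G th) <= c%:E)%E] = 0 ->
  Lam (fun s => nu (L s)) <= c * nu setT.
Proof.
move=> fnu c0 nubad; have [LD LZ Lmono LP] := HLam.
have [nu0 nuU] := fnu.
have [Y HY] := polyh_approx z fnu.
pose ins s n := [seq i <- iota 0 n | `[< Y i `<=` L s >]].
pose U s n := cup Y (ins s n).
have UL s n : U s n `<=` L s.
  by move=> t [i]; rewrite mem_filter => /andP[/asboolP YL _]; exact: YL.
have Umono s m n : (m <= n)%N -> U s m `<=` U s n.
  move=> mn t [i]; rewrite mem_filter mem_iota add0n => /andP[YL im] Yi.
  by exists i => //; rewrite mem_filter YL mem_iota add0n (leq_trans im).
have Uapprox s eta : 0 < eta -> exists n, nu (L s) <= nu (U s n) + eta.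
  move=> /(HY (ls s))[F [FL Fe]]; exists (\max_(i <- F) i).+1.
  rewrite (fin_additive_split _ (cup Y F) fnu); apply: lerD => //.
  apply: fin_additive_le => // t [_ [i iF Yi]]; exists i => //.
  rewrite mem_filter mem_iota add0n ltnS leq_bigmax_seq// andbT.
  by rewrite leq0n andbT; apply/asboolP; exact: FL.
have nuT X : nu X <= nu setT by exact: fin_additive_le.
have bnu (X : T -> set Z) : bounded_fct (fun s => nu (X s)).
  by exists (nu setT) => s; rewrite ger0_norm.
have LU n : Lam (fun s => nu (U s n)) <= c * nu setT.
  (* The first [n] sets cut [Z] into finitely many cells, and [U s n] is the union of the cells [w]
     with [s] in [hit w]. If a cell contains a policy [th] with [P (G th)] at most [c], then [hit w]
     is contained in [G th]; otherwise the cell is null. *)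
  pose kappa th := [set i : 'I_n | `[< Y i th >]]%SET.
  pose cell (w : {set 'I_n}) := [set th | kappa th = w].
  pose hit (w : {set 'I_n}) := [set s | exists2 i : 'I_n, i \in w & Y i `<=` L s].
  have bh w : bounded_fct (fun s : T => nu (cell w) * \1_(hit w) s).
    by apply: bounded_scale; exact: bounded_indic.
  apply: (@le_trans _ _ (Lam (fun s => \sum_w nu (cell w) * \1_(hit w) s))).
    apply: Lmono => //; first exact: bounded_sum.
    move=> s; rewrite (fin_additive_partition kappa (U s n) fnu).
    apply: ler_sum => w _; rewrite indicE; have [hs|nhs] := boolP (s \in hit w).
      by rewrite mulr1; apply: fin_additive_le => //; exact: subIsetr.
    rewrite mulr0 (_ : _ `&` _ = set0) ?fin_additive0//.
    apply/seteqP; split=> // th [[i]]; rewrite mem_filter mem_iota add0n.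
    move=> /andP[/asboolP YL im] Yi /= kw; move/negP: nhs; apply.
    by rewrite inE; exists (Ordinal im) => //; rewrite -kw inE; apply/asboolP.
  rewrite (mean_sum HLam)// (fin_additive_partition kappa setT fnu) mulr_sumr.
  apply: ler_sum => w _; rewrite setTI LZ; last exact: bounded_indic.
  have [[th [cw Pth]]|/forallNP none] :=
    pselect (exists th, cell w th /\ (P (G th) <= c%:E)%E).
    rewrite mulrC; apply: ler_wpM2r => //; rewrite -lee_fin; apply: le_trans Pth.
    rewrite -LP// lee_fin; apply: Lmono; try exact: bounded_indic.
    move=> s; rewrite !indicE ler_nat; case: (boolP (s \in hit w)) => // /set_mem.
    move=> [i iw YL]; rewrite mem_set//; apply: YL.
    by move: iw; rewrite -cw inE => /asboolP.
  have -> : nu (cell w) = 0; last by rewrite mul0r mulr0.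
  apply/le_anti; rewrite nu0 andbT -nubad; apply: fin_additive_le => // th cw /= H.
  by apply: (none th).
(* [ins s n] takes finitely many values, each decided by the measurable inclusions of the [Y i] in
   [L s]. *)
have mins n (Q : seq nat -> Prop) : measurable [set s | Q (ins s n)].
  elim: n Q => [|n IH] Q.
    have [q|nq] := pselect (Q [::]).
      by rewrite (_ : [set _ | _] = setT)//; apply/seteqP; split.
    by rewrite (_ : [set _ | _] = set0)//; apply/seteqP; split.
  have mY := measurable_subset_polyh (Y n).
  rewrite (_ : [set _ | _] =
    ([set s | Y n `<=` L s] `&` [set s | Q (rcons (ins s n) n)]) `|`
    (~` [set s | Y n `<=` L s] `&` [set s | Q (ins s n)])).
    apply: measurableU; apply: measurableI => //.
    - exact: IH (fun u => Q (rcons u n)).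
    - exact: measurableC.
  have insS s : ins s n.+1 = if `[< Y n `<=` L s >] then rcons (ins s n) n
      else ins s n.
    by rewrite /ins -addn1 iotaD add0n filter_cat/=; case: ifP; rewrite ?cats0 ?cats1.
  apply/seteqP; split=> s /=; rewrite insS.
    by case: asboolP => YL Qs; [left|right].
  by case: asboolP => YL [] [].
apply/ler_addgt0Pr => e e0.
(* The final error is [2 * eta] on [A n] plus [nu setT * eta] from its complement. *)
pose eta := e / (2 + nu setT).
have nuT0 : 0 <= nu setT by [].
have eta0 : 0 < eta by rewrite divr_gt0// ltr_wpDr.
(* The samples for which later sets gain at most [eta]. These measurable events increase to the
   whole space, so countable additivity of [P] makes one [n] good for all but [eta] of the
   samples. *)
pose A n := [set s | forall q, nu (U s (n + q)%N) <= nu (U s n) + eta].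
have mA n : measurable (A n).
  rewrite (_ : A n = \bigcap_q [set s | nu (U s (n + q)%N) <= nu (U s n) + eta]).
    apply: bigcapT_measurable => q.
    have := mins (n + q)%N (fun u => nu (cup Y u) <=
      nu (cup Y [seq i <- u | (i < n)%N]) + eta).
    congr measurable.
    have insE s : [seq i <- ins s (n + q) | (i < n)%N] = ins s n.
      rewrite /ins iotaD add0n !filter_cat -[RHS]cats0; congr (_ ++ _).
        apply/all_filterP/allP => i; rewrite mem_filter mem_iota add0n.
        by move=> /andP[_].
      apply/eqP; rewrite -[_ == _]negbK -has_filter; apply/hasPn => i.
      by rewrite mem_filter mem_iota -leqNgt => /and3P[].
    by apply/seteqP; split=> s /=; rewrite insE.
  by apply/seteqP; split=> [s As q _|s As q]; [exact: As|exact: (As q I)].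
have Amono : {homo A : n m / (n <= m)%N >-> (n <= m)%O}.
  move=> n m nm; apply/subsetPset => s As q.
  rewrite -(subnKC nm) -addnA; apply: (le_trans (As _)); rewrite lerD2r.
  by apply: fin_additive_le => //; apply: Umono; exact: leq_addr.
have AT : \bigcup_n A n = setT.
  apply/seteqP; split=> // s _; have [n Hn] := Uapprox s _ eta0.
  by exists n => // q; apply: le_trans Hn; exact: fin_additive_le.
have [n An] : exists n, Lam \1_(~` A n) <= eta.
  have : P (A n) @[n --> \oo] --> 1%:E.
    rewrite -(probability_setT P) -AT; apply: nondecreasing_cvg_mu => //.
    by rewrite AT.
  move=> /fine_cvg /cvgrPdist_le /(_ _ eta0)[n _ /(_ n (leqnn n))].
  move=> /= H; exists n; rewrite -lee_fin LP; last exact: measurableC.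
  rewrite probability_setC// -(fineK (fin_num_measure P _ (mA n))) -EFinB lee_fin.
  exact: le_trans (ler_norm _) H.
apply: (@le_trans _ _ (Lam (fun s => nu (U s n) + (2 * eta + nu setT * \1_(~` A n) s)))).
  apply: Lmono => //.
    apply: bounded_add => //; apply: bounded_add; first exact: bounded_cst.
    by apply: bounded_scale; exact: bounded_indic.
  move=> s; rewrite indicE; have [nAs|As] := boolP (s \in ~` A n).
    by rewrite mulr1 addrA; apply: (le_trans (nuT _)); rewrite lerDr addr_ge0// mulr_ge0// ltW.
  have {}As : A n s by apply: contrapT => H; move/negP: As; apply; exact/mem_set.
  rewrite mulr0; have [q Hq] := Uapprox s _ eta0; have := As q.
  have := fin_additive_le fnu (Umono s q (n + q)%N (leq_addl _ _)); lra.
rewrite LD//; last first.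
  by apply: bounded_add; [exact: bounded_cst|apply: bounded_scale; exact: bounded_indic].
apply: lerD (LU n) _; rewrite LD; [|exact: bounded_cst|by apply: bounded_scale; exact: bounded_indic].
rewrite (mean_cst HLam) LZ; last exact: bounded_indic.
rewrite (_ : e = 2 * eta + nu setT * eta).
  by rewrite lerD2l ler_wpM2l.
by rewrite -mulrDl mulrC /eta divfK// gt_eqF// ltr_wpDr.
Qed.

Lemma mean_iter_indic_le k (A B : set (seq T)) : (forall s, A s -> B s) ->
  mean_iter Lam k \1_A <= mean_iter Lam k \1_B.
Proof.
move=> AB; apply: (mean_iter_le HLam); try exact: bounded_indic.
move=> s _; rewrite !indicE ler_nat; case: (boolP (s \in A)) => // /set_mem/AB Bs.
by rewrite mem_set.
Qed.

Definition unmasked_feasible (b : seq bool) (theta : seq T -> Z) (D : set (seq T)) :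
    set (seq T) :=
  [set s | D (mask b s) /\
    all (fun t => `[< L t (theta (mask b s)) >]) (mask (map negb b) s)].

(** Induction on the mask. A leading sample of the subsample is frozen into [theta] and [D]; any
    other leading sample costs a factor [c] by [mean_content_le]. *)
Lemma mean_iter_mask_le (b : seq bool) (theta : seq T -> Z) (D : set (seq T))
    (c : R) :
  0 <= c -> (forall u, D u -> (P (G (theta u)) <= c%:E)%E) ->
  mean_iter Lam (size b) \1_(unmasked_feasible b theta D) <= c ^+ count negb b.
Proof.
move=> c0; elim: b theta D => [|[] b IH] theta D Dc /=.
- by rewrite expr0 indicE lern1 leq_b1.
- rewrite add0n -[leRHS](mean_cst HLam); have [_ _ Lmono _] := HLam.
  apply: Lmono; [|exact: bounded_cst|].
    by apply: (bounded_mean_iter HLam); exact: bounded_indic.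
  move=> t; apply: (IH (fun u => theta (t :: u)) (fun u => D (t :: u))) => u.
  exact: Dc.
(* The distribution of the policy over the remaining samples, restricted to the event that those
   constraints hold; the leading sample is averaged outside it. *)
pose nu (X : set Z) := mean_iter Lam (size b)
  \1_(unmasked_feasible b theta D `&` [set s | X (theta (mask b s))]).
have fnu : fin_additive nu.
  split=> [X|X Y XY].
    rewrite -(mean_iter_cst HLam (size b) 0).
    by apply: (mean_iter_le HLam); [exact: bounded_cst|exact: bounded_indic|].
  rewrite /nu -(mean_iterD HLam); try exact: bounded_indic.
  congr (mean_iter _ _ _); apply/funext => s; rewrite !indicE.
  have disj : ~ (X (theta (mask b s)) /\ Y (theta (mask b s))).
    by move=> XYs; have : (X `&` Y) (theta (mask b s)) by []; rewrite XY.
  have memE (V : set Z) :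
      (s \in unmasked_feasible b theta D `&` [set s | V (theta (mask b s))]) =
      (s \in unmasked_feasible b theta D) && `[< V (theta (mask b s)) >].
    apply/idP/andP => [/set_mem[ks Vs]|[/set_mem ks /asboolP Vs]].
      by split; [exact/mem_set|exact/asboolP].
    exact/mem_set.
  rewrite !memE -natrD; congr (_%:R); case: (s \in _) => //=.
  rewrite asbool_or; by do 2 case: asboolP => //=; tauto.
rewrite add1n exprS; apply: (@le_trans _ _ (Lam (fun t => nu (L t)))).
  rewrite le_eqVlt; apply/orP; left; apply/eqP.
  congr (Lam _); apply/funext => t; congr (mean_iter _ _ _).
  apply/funext => s; rewrite !indicE; congr (nat_of_bool _)%:R.
  apply/idP/idP => /set_mem H; apply/mem_set.
    by move: H => [Ds /= /andP[/asboolP Lt al]].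
  by move: H => [[Ds al] Lt]; split=> //=; rewrite al andbT; apply/asboolP.
have nubad : nu [set th | ~ (P (G th) <= c%:E)%E] = 0.
  rewrite /nu -[RHS](mean_iter_cst HLam (size b) 0); congr (mean_iter _ _ _).
  apply/funext => s; rewrite indicE memNset// => -[[Ds _] /=]; apply.
  exact: Dc.
apply: (le_trans (mean_content_le fnu c0 nubad)); rewrite ler_wpM2l//.
by apply: le_trans (IH theta D Dc); apply: mean_iter_indic_le => s [].
Qed.

End RandomPolyhedron.

(** * Policies *)

Section PolicyCoordinates.
Variables (R : realType) (m l N : nat).
Let J : finType := option ('I_N * 'I_m * option 'I_l).

(** The index [None] carries the constant 1, which turns affine functions of a policy into linear
    ones. *)
Definition policy_coord (Cd : policy R m l N) (j : J) : R :=
  match j with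
  | None => 1
  | Some (i, a, None) => Cd.2 i a 0
  | Some (i, a, Some b) => Cd.1 i a b
  end.

Definition policy_vec (Cd : policy R m l N) : 'cV[R]_#|J| :=
  \col_k policy_coord Cd (enum_val k).

Definition policy_affine (f : policy R m l N -> R) : Prop :=
  exists v : 'rV[R]_#|J|, forall Cd, f Cd = (v *m policy_vec Cd) 0 0.

Lemma policy_affine_coord j : policy_affine (fun Cd => policy_coord Cd j).
Proof.
exists (delta_mx 0 (enum_rank j)) => Cd.
by rewrite -rowE !mxE enum_rankK.
Qed.

Lemma policy_affineZ c f : policy_affine f -> policy_affine (fun Cd => c * f Cd).
Proof. by move=> [v Hv]; exists (c *: v) => Cd; rewrite Hv -scalemxAl [RHS]mxE. Qed.

Lemma policy_affineD f g : policy_affine f -> policy_affine g ->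
  policy_affine (fun Cd => f Cd + g Cd).
Proof.
by move=> [v Hv] [w Hw]; exists (v + w) => Cd; rewrite Hv Hw mulmxDl [RHS]mxE.
Qed.

Lemma policy_affine_cst c : policy_affine (fun=> c).
Proof.
have [v Hv] := policy_affineZ c (policy_affine_coord None).
by exists v => Cd; rewrite -Hv mulr1.
Qed.

Lemma policy_affine_sum (I : finType) (f : I -> policy R m l N -> R) :
  (forall i, policy_affine (f i)) -> policy_affine (fun Cd => \sum_i f i Cd).
Proof.
move=> /choice[v Hv]; exists (\sum_i v i) => Cd.
by rewrite mulmx_suml summxE; apply: eq_bigr => i _.
Qed.

Lemma policy_affine_mulmx p q (M : 'M[R]_(p, q)) (u : policy R m l N -> 'cV[R]_q) j :
  (forall k, policy_affine (fun Cd => u Cd k 0)) ->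
  policy_affine (fun Cd => (M *m u Cd) j 0).
Proof.
move=> Hu.
have [v Hv] := @policy_affine_sum 'I_q (fun k Cd => M j k * u Cd k 0)
  (fun k => policy_affineZ (M j k) (Hu k)).
by exists v => Cd; rewrite -Hv mxE.
Qed.

Lemma policy_affine_input i (dv : 'cV[R]_l) k :
  policy_affine (fun Cd => (Cd.1 i *m dv + Cd.2 i) k 0).
Proof.
have [v Hv] := policy_affineD
  (@policy_affine_sum 'I_l (fun b Cd => dv b 0 * policy_coord Cd (Some (i, k, Some b)))
    (fun b => policy_affineZ (dv b 0) (policy_affine_coord (Some (i, k, Some b)))))
  (policy_affine_coord (Some (i, k, None))).
exists v => Cd; rewrite -Hv !mxE; congr (_ + _).
by apply: eq_bigr => b _; rewrite mulrC.
Qed.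

Lemma polyh_affine (I : finType) (f : I -> policy R m l N -> R) :
  (forall i, policy_affine (f i)) ->
  exists ls, forall Cd, polyh policy_vec ls Cd <-> forall i, 0 <= f i Cd.
Proof.
move=> /choice[v Hv]; exists [seq v i | i <- enum I] => Cd; split.
  by move=> H i; rewrite Hv; apply: H; rewrite map_f// mem_enum.
by move=> H _ /mapP[i _ ->]; rewrite -Hv.
Qed.

Lemma Lset_polyh n (Uc : set 'cV[R]_m) (S : set 'cV[R]_n)
    (A : 'cV[R]_l -> 'M[R]_n) (B : 'cV[R]_l -> 'M[R]_(n, m))
    (x : 'I_N -> 'cV[R]_n) (dv : 'cV[R]_l) :
  polyhedral Uc -> polyhedral S ->
  exists ls, forall Cd, polyh policy_vec ls Cd <-> Lset Uc S A B x dv Cd.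
Proof.
move=> [p [F [g ->]]] [q [F' [g' ->]]].
pose u i (Cd : policy R m l N) := Cd.1 i *m dv + Cd.2 i.
pose f (o : 'I_N * ('I_p + 'I_q)) Cd := match o.2 with
  | inl j => g j 0 - (F *m u o.1 Cd) j 0
  | inr j => g' j 0 - (F' *m (A dv *m x o.1 + B dv *m u o.1 Cd)) j 0
  end.
have sub (c : R) h : policy_affine h -> policy_affine (fun Cd => c - h Cd).
  move=> Hh; have [v Hv] := policy_affineD (policy_affine_cst c) (policy_affineZ (-1) Hh).
  by exists v => Cd; rewrite -Hv mulN1r.
have [|ls Hls] := @polyh_affine _ f.
  move=> [i [j|j]]; apply: sub; apply: policy_affine_mulmx => k.
    exact: policy_affine_input.
  have [v Hv] := policy_affineD (policy_affine_cst ((A dv *m x i) k 0))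
    (policy_affine_mulmx (B dv) k (policy_affine_input i dv)).
  by exists v => Cd; rewrite -Hv mxE.
exists ls => Cd; rewrite Hls; split=> [H i|H [i [j|j]]].
- by split=> j; rewrite -subr_ge0; [exact: (H (i, inl j))|exact: (H (i, inr j))].
- by rewrite /f/= subr_ge0; case: (H i) => + _; apply.
- by rewrite /f/= subr_ge0; case: (H i) => _; apply.
Qed.

End PolicyCoordinates.

Lemma Lmulti_all (R : realType) (T : Type) (n m l N : nat) (emb : T -> 'cV[R]_l)
    (Uc : set 'cV[R]_m) (S : set 'cV[R]_n)
    (A : 'cV[R]_l -> 'M[R]_n) (B : 'cV[R]_l -> 'M[R]_(n, m))
    (x : 'I_N -> 'cV[R]_n) (s : seq T) (Cd : policy R m l N) :
  Lmulti emb Uc S A B x s Cd <->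
  all (fun t => `[< Lset Uc S A B x (emb t) Cd >]) s.
Proof.
elim: s => //= t s IH; split=> [[Lt /IH ->]|/andP[/asboolP Lt /IH]//].
by rewrite andbT; apply/asboolP.
Qed.

(** * Index sets, their count by cardinality, and their masks *)

Lemma sum_bin_card (R : realType) K (a : nat -> R) :
  \sum_(h < K) 'C(K, h)%:R * a h =
  \sum_(I : {set 'I_K} | (#|I| < K)%N) a #|I|.
Proof.
transitivity (\sum_(h < K) \sum_(I : {set 'I_K} | #|I| == h) a h).
  apply: eq_bigr => h _; rewrite sumr_const -[RHS]mulr_natl; congr (_%:R * _).
  by rewrite -[K in 'C(K, _)]card_ord -card_draws cardsE.
rewrite (exchange_big_dep (fun I : {set 'I_K} => (#|I| < K)%N))/=; last first.
  by move=> h I _ /eqP ->.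
by apply: eq_bigr => I IK; rewrite (big_pred1 (Ordinal IK)).
Qed.

Definition set_mask K (I : {set 'I_K}) : seq bool := [seq i \in I | i <- enum 'I_K].

Lemma size_set_mask K (I : {set 'I_K}) : size (set_mask I) = K.
Proof. by rewrite size_map size_enum_ord. Qed.

Lemma count_set_mask K (I : {set 'I_K}) : count negb (set_mask I) = (K - #|I|)%N.
Proof.
have := count_predC id (set_mask I); rewrite size_set_mask.
have -> : count id (set_mask I) = #|I|.
  by rewrite count_map -size_filter cardE enumT /enum_mem.
by move=> H; rewrite -[X in (X - _)%N]H addKn; apply: eq_count.
Qed.

Lemma mask_set_mask (T : Type) K (s : K.-tuple T) (I : {set 'I_K}) :
  mask (set_mask I) s = [seq tnth s i | i <- enum I].
Proof.
by rewrite -{1}(map_tnth_enum s) -map_mask -filter_mask enumT.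
Qed.

Theorem theorem1 (R : realType) (n m l N K : nat)
  (d : measure_display) (T : measurableType d) (P : probability T R)
  (emb : T -> 'cV[R]_l) (Hemb : injective emb)
  (A : 'cV[R]_l -> 'M[R]_n) (B : 'cV[R]_l -> 'M[R]_(n, m))
  (X : set 'cV[R]_n) (Uc : set 'cV[R]_m) (S : set 'cV[R]_n)
  (x : 'I_N -> 'cV[R]_n)
  (HX : Cset X) (HU : Cpolytope Uc) (HS : Cpolytope S) (HSX : S `<=` X)
  (Hx : vertices_of S x)
  (beta : R) (Hbeta : 0 < beta < 1)
  (eps : nat -> R) (Heps : forall h, (h <= K)%N -> 0 <= eps h <= 1)
  (HepsK : eps K = 1)
  (Hsum : \sum_(h < K) ('C(K, h))%:R * (1 - eps h) ^+ (K - h) = beta)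
  (Hfeas : forall s : K.-tuple T, exists Cd, Lmulti emb Uc S A B x s Cd)
  (Theta : seq T -> policy R m l N)
  (HTheta : forall s : seq T, (exists Cd, Lmulti emb Uc S A B x s Cd) ->
              Lmulti emb Uc S A B x s (Theta s))
  (Ups : K.-tuple T -> {set 'I_K})
  (HUps : forall s : K.-tuple T,
            Theta [seq tnth s i | i <- enum (Ups s)] = Theta s)
  (HmeasV : forall Cd : policy R m l N,
     measurable [set t : T | ~ Uset Uc S (A (emb t)) (B (emb t)) x
                                   (apply_policy Cd (emb t))])
  (HmeasE : measurable [set s : K.-tuple T |
     ((eps #|Ups s|)%:E < violation P emb Uc S A B x (Theta s))%E]) :
  (pow_prob P [set s : K.-tuple T |
     ((eps #|Ups s|)%:E < violation P emb Uc S A B x (Theta s))%E]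
   <= beta%:E)%E.

Proof.
have [Lam HLam] := exists_mean P.
have [[_ HUp] [_ HSp]] := (HU, HS).
have [ls Hls] := choice (fun t : T => Lset_polyh A B x (emb t) HUp HSp).
pose G (Cd : policy R m l N) := [set t | polyh (@policy_vec R m l N) (ls t) Cd].
pose bad (Cd : policy R m l N) :=
  [set t : T | ~ Uset Uc S (A (emb t)) (B (emb t)) x (apply_policy Cd (emb t))].
have GE Cd : G Cd = ~` bad Cd.
  apply/seteqP; split=> t /=; first by move=> /Hls H; apply.
  by move=> /contrapT H; apply/Hls.
have mG Cd : measurable (G Cd) by rewrite GE; apply: measurableC; exact: HmeasV.
have PG Cd (h : R) : (h%:E < P (bad Cd))%E -> (P (G Cd) <= (1 - h)%:E)%E.
  move=> hV; rewrite GE probability_setC; last exact: HmeasV.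
  by rewrite EFinB leeB// ltW.
pose D h : set (seq T) := [set u | ((eps h)%:E < P (bad (Theta u)))%E].
pose KI (I : {set 'I_K}) : set (seq T) :=
  unmasked_feasible (@policy_vec R m l N) ls (set_mask I) Theta (D #|I|).
set E := [set s : K.-tuple T | _].
apply: (@le_trans _ _ (mean_iter Lam K
  (\1_[set s' : seq T | exists t : K.-tuple T, tval t = s' /\ E t]))%:E).
  apply: (proj2 (iter_int_le_mean HLam _ _ _ _)) => //; exact: bounded_indic.
rewrite lee_fin.
(* Union bound over the possible values of the support index set. *)
apply: (@le_trans _ _ (mean_iter Lam K
  (fun s => \sum_(I : {set 'I_K} | (#|I| < K)%N) \1_(KI I) s))).
  apply: (mean_iter_le HLam); first exact: bounded_indic.
    by apply: bounded_sum => I; exact: bounded_indic.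
  move=> s _; rewrite indicE; case: (boolP (s \in _)) => [/set_mem|_]; last first.
    by apply: sumr_ge0 => I _; rewrite indicE.
  move=> [t [<- Et]] {s}.
  (* With all [K] indices, [eps K = 1] would ask for a violation probability above 1. *)
  have IK : (#|Ups t| < K)%N.
    have : (#|Ups t| <= K)%N by rewrite -[leqRHS]card_ord max_card.
    rewrite leq_eqVlt => /predU1P[UK|//]; move: Et; rewrite /E/= UK HepsK.
    by rewrite ltNge probability_le1.
  rewrite (bigD1 (Ups t))//= indicE mem_set ?lerDl.
    by apply: sumr_ge0 => I _; rewrite indicE.
  (* The support subsample yields the policy of the full multisample, which is feasible for every
     sample, in particular for those left out. *)
  rewrite /KI /unmasked_feasible /= mask_set_mask HUps; split; first by rewrite /D/= HUps.
  have /Lmulti_all := HTheta t (Hfeas t).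
  move=> al; apply: all_mask; apply: sub_all al => v /asboolP /Hls Hv.
  exact/asboolP.
rewrite (mean_iter_sum HLam); last by move=> I; exact: bounded_indic.
rewrite -Hsum (@sum_bin_card R K (fun h => (1 - eps h) ^+ (K - h))); apply: ler_sum => I IK.
have := @mean_iter_mask_le _ _ _ _ _ HLam _ _ _ _ mG (set_mask I) Theta (D #|I|) (1 - eps #|I|).
rewrite size_set_mask count_set_mask; apply.
  by rewrite subr_ge0; case/andP: (Heps _ (ltnW IK)).
by move=> u; exact: PG.
Qed.
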